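(* Let $\beta: \mathbb{G}_a \to \operatorname{GL}(\mathbf{V})$ be an $n$-dimensional linear representation over $k$ such that the large pedestal ideal $\mathfrak{P}_g(S_k(\mathbf{V}^\ast))$ is equal to zero. Then $S_k(\mathbf{V}^\ast)^{\mathbb{G}_a} = S_k\left((\mathbf{V}^\ast)^{\mathbb{G}_a}\right)$.
   Context: $k$ is an algebraically closed field and $\mathbb{G}_a=\operatorname{Spec}(k[t])$. $S_k(\mathbf{V}^\ast)$ is the symmetric algebra of the dual space $\mathbf{V}^\ast$, i.e. the coordinate ring of $\mathbf{V}$, with the induced $\mathbb{G}_a$-action and co-action $\beta^\sharp$. A polynomial $c(t)\in k[t]$ is additive if $c(s+t)=c(s)+c(t)$. For an affine $\mathbb{G}_a$-variety $\operatorname{Spec}(A)$ with co-action $\beta^\sharp: A\to A[t]$ and an additive polynomial $c(t)$, a $c(t)$-pair is a pair $(g,h)$ with $g\in A$, $h\in A^{\mathbb{G}_a}$ and $\beta^\sharp(g)=g+c(t)h$. The large pedestal ideal $\mathfrak{P}_g(A)$ is the ideal of $A$ generated by all $h$ for which there exist a non-zero additive polynomial $c(t)$ and a $g\in A$ such that $(g,h)$ is a $c(t)$-pair. *)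

(* Defs.v *)
From HB Require Import structures.
From mathcomp Require Import all_boot all_order all_algebra.
From mathcomp Require Import mpoly.

Set Implicit Arguments.
Unset Strict Implicit.
Unset Printing Implicit Defensive.

Import GRing.Theory.
Local Open Scope ring_scope.

(* c(s + t) = c(s) + c(t) as an identity in k[s, t], with s = 'X and t = 'Y. *)
Definition additive_poly (k : fieldType) (c : {poly k}) : Prop :=
  poly_XaY c = c^:P + c%:P.

(* Here k is a field, A a commutative k-algebra, and b : A -> A[t] the
   co-action of G_a = Spec k[t] on Spec A. *)

Definition Ga_invariant (k : fieldType) (A : comAlgType k) (b : A -> {poly A})
  (f : A) : Prop := b f = f%:P.

(* (map_poly (in_alg A) c) is c(t) viewed in A[t], so the last clause reads
   b(g) = g + c(t) h. *)
Definition is_pair (k : fieldType) (A : comAlgType k) (b : A -> {poly A})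
  (c : {poly k}) (g h : A) : Prop :=
  Ga_invariant b h /\ b g = g%:P + map_poly (in_alg A) c * h%:P.

Definition large_pedestal_gen (k : fieldType) (A : comAlgType k)
  (b : A -> {poly A}) (h : A) : Prop :=
  exists (c : {poly k}) (g : A),
    [/\ c != 0, additive_poly c & is_pair b c g h].

Definition ideal_gen (A : comNzRingType) (P : A -> Prop) (f : A) : Prop :=
  exists (m : nat) (a h : 'I_m -> A),
    (forall i, P (h i)) /\ f = \sum_(i < m) a i * h i.

Definition large_pedestal_ideal (k : fieldType) (A : comAlgType k)
  (b : A -> {poly A}) : A -> Prop := ideal_gen (large_pedestal_gen b).

(* Since G_a = Spec k[t], a morphism of schemes G_a -> GL(V) with V = k^n
   (column vectors) is a k[t]-point of GL_n, i.e. an invertible matrix M over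
   k[t].  It is a homomorphism when M(s + t) = M(s) M(t) over k[s, t], where
   again s = 'X and t = 'Y. *)
Record Ga_rep (k : fieldType) (n : nat) := GaRep {
  rep_mx :> 'M[{poly k}]_n;
  rep_mx_unit : rep_mx \in unitmx;
  rep_mxD : map_mx (@poly_XaY k) rep_mx
            = map_mx (map_poly polyC) rep_mx *m map_mx polyC rep_mx
}.

(* S_k(V^* ) = {mpoly k[n]}, where 'X_0, ..., 'X_(n-1) is the basis of V^* dual
   to the standard basis of V = k^n.  The co-action is the comorphism of the
   action (t, v) |-> M(t) v, i.e. the k-algebra morphism sending f to
   f(M(t) v), so that 'X_i is sent to \sum_j M(t)_ij 'X_j. *)
Definition coaction (k : fieldType) (n : nat) (M : Ga_rep k n)
  (f : {mpoly k[n]}) : {poly {mpoly k[n]}} :=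
  mmap (polyC \o @mpolyC n k)
       (fun i : 'I_n =>
          \sum_(j < n) map_poly (@mpolyC n k) (M i j) * ('X_j)%:P)
       f.

(* V^* is the space of linear forms: the degree 1 part of S_k(V^* ). *)
Definition dual_invariant (k : fieldType) (n : nat) (M : Ga_rep k n)
  (l : {mpoly k[n]}) : Prop :=
  l \is 1.-homog /\ Ga_invariant (coaction M) l.

(* For a subspace W of V^*, S_k(W) is the k-subalgebra of S_k(V^* ) generated
   by W: the polynomial expressions in finitely many elements of W. *)
Definition sym_sub (k : fieldType) (n : nat) (W : {mpoly k[n]} -> Prop)
  (f : {mpoly k[n]}) : Prop :=
  exists (m : nat) (w : m.-tuple {mpoly k[n]}) (p : {mpoly k[m]}),
    (forall i, W (tnth w i)) /\ f = p \mPo w.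

(* Main.v *)
Require Import Defs.
From mathcomp Require Import all_boot all_order all_algebra.
From mathcomp Require Import mpoly zify ring.
From Stdlib Require Import Classical.

(** Let [M(t) = \sum_N M_N t^N] act on [V^*].  The group law says
    [M_a M_b = 'C(a + b, a) M_(a + b)], so the [M_N] commute.  Put
    [W = (V^* )^Ga].  If the pedestal ideal vanishes, then [V^* = W + k l] for
    some [l].  Otherwise choose [l], [v] independent modulo [W] that are fixed
    modulo [W] (if [v] only moves inside [W + k l], commutativity of the [M_N]
    already yields a pair for [l]).  Write [l |-> l + C_l] and
    [v |-> v + C_v], where [C_l], [C_v] are additive in [t] and linear in the
    variables.
    - If they are proportional over [k(t)], comparing degrees shows that they
      are proportional over [k], or that one of them is [c(t) w], a pair.
    - Otherwise let [E] be a non-zero additive polynomial of least degree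
      among the [b g - g] with invariant coefficients.  Up to factors free of
      [t], it divides [C_l] and [C_v], say [h C_l = F E] and [h C_v = G E], so
      [F C_v = G C_l].  As [C_l] is a linear form, it is prime over [k(t)] and
      divides [F]; hence [E] divides some [d(t) h], and since [d] splits over
      [k], [E = c(t) e] is a pair.
    Finally, an invariant [f] is [q(l)] with [q] over [S(W)], and
    [q(l + C_l)] has [t]-degree [deg q * deg C_l], so [deg q = 0]. *)

Set Implicit Arguments.
Unset Strict Implicit.
Unset Printing Implicit Defensive.

Import GRing.Theory.
Local Open Scope ring_scope.

(** * Additive polynomials over a commutative ring *)

Definition additive_over (A : comNzRingType) (E : {poly A}) : Prop :=
  poly_XaY E = E^:P + E%:P.

(** Taylor expansion: the coefficient of the [i]-th power of the outer variable is the [i]-th Hasse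
    derivative of [p]. This needs no division by factorials, hence holds in every characteristic. *)
Lemma coef_poly_XaY (A : comNzRingType) (p : {poly A}) i j :
  (poly_XaY p)`_i`_j = p`_(i + j) *+ 'C(i + j, i).
Proof.
pose P := p^:P.
have nderivY m : (P^:P)^`N(m).['X%:P] = (p^`N(m))%:P :> {poly {poly A}}.
  rewrite /P nderivn_map /= horner_map /=.
  by rewrite nderivn_map -/(comp_poly 'X _) comp_polyXr.
rewrite /poly_XaY /comp_poly addrC nderiv_taylor; last exact: mulrC.
rewrite coef_sum (eq_bigr (fun m : 'I_(size P^:P) =>
  if m == i :> nat then p^`N(i) else 0)); last first.
  move=> m _; rewrite nderivY coefCM coefXn eq_sym.
  by case: eqP => [->|_]; rewrite ?mulr1 ?mulr0.
rewrite -big_mkcond /=; case: (ltnP i (size P^:P)) => [lti|gei].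
  by rewrite (big_pred1 (Ordinal lti)) // coef_nderivn.
rewrite big_pred0 => [|m]; last first.
  by apply/negP => /eqP e; move: (ltn_ord m); rewrite e ltnNge gei.
rewrite coef0 nth_default ?mul0rn //.
by rewrite !size_map_polyC in gei; rewrite (leq_trans gei) ?leq_addr.
Qed.

Lemma additive_overP (A : comNzRingType) (E : {poly A}) :
  additive_over E <->
  (forall i j, E`_(i + j) *+ 'C(i + j, i) =
     (if j == 0%N then E`_i else 0) + (if i == 0%N then E`_j else 0)).
Proof.
have coefR i j : (E^:P + E%:P)`_i`_j =
    (if j == 0%N then E`_i else 0) + (if i == 0%N then E`_j else 0).
  rewrite coefD coef_map /= coefC coefD coefC.
  by case: (i == 0)%N; rewrite ?coef0.
split=> [addE i j | E_bin].
  by rewrite -coef_poly_XaY addE coefR.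
by apply/polyP=> i; apply/polyP=> j; rewrite coef_poly_XaY E_bin coefR.
Qed.

Lemma additive_over_coef0 (A : comNzRingType) (E : {poly A}) :
  additive_over E -> E`_0 = 0.
Proof.
move/additive_overP=> /(_ 0 0)%N; rewrite bin0 mulr1n eqxx => /esym/eqP.
by rewrite -subr_eq0 addrK => /eqP.
Qed.

Lemma additive_over_bin (A : comNzRingType) (E : {poly A}) i j :
  additive_over E -> (0 < i)%N -> (0 < j)%N -> E`_(i + j) *+ 'C(i + j, i) = 0.
Proof.
by move=> /additive_overP-> i0 j0; rewrite !gtn_eqF // addr0.
Qed.

Lemma additive_overI (A : comNzRingType) (E : {poly A}) :
  E`_0 = 0 ->
  (forall i j, (0 < i)%N -> (0 < j)%N -> E`_(i + j) *+ 'C(i + j, i) = 0) ->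
  additive_over E.
Proof.
move=> E0 Ebin; apply/additive_overP=> -[|i] [|j].
- by rewrite addn0 bin0 mulr1n !eqxx E0 addr0.
- by rewrite add0n bin0 mulr1n add0r.
- by rewrite addn0 binn mulr1n addr0.
- by rewrite Ebin // addr0.
Qed.

Lemma poly_XaYD (A : comNzRingType) (p q : {poly A}) :
  poly_XaY (p + q) = poly_XaY p + poly_XaY q.
Proof. by rewrite /poly_XaY rmorphD comp_polyD. Qed.

Lemma poly_XaYM (A : comNzRingType) (p q : {poly A}) :
  poly_XaY (p * q) = poly_XaY p * poly_XaY q.
Proof. by rewrite /poly_XaY rmorphM /= comp_polyM. Qed.

Lemma poly_XaYXn (A : comNzRingType) (p : {poly A}) m :
  poly_XaY (p ^+ m) = poly_XaY p ^+ m.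
Proof.
elim: m => [|m IH]; last by rewrite !exprS poly_XaYM IH.
by rewrite /poly_XaY !expr0 rmorph1 comp_polyC.
Qed.

Lemma additive_overD (A : comNzRingType) (E F : {poly A}) :
  additive_over E -> additive_over F -> additive_over (E + F).
Proof.
rewrite /additive_over => addE addF.
by rewrite poly_XaYD addE addF !rmorphD /= addrACA.
Qed.

Lemma additive_overMC (A : comNzRingType) (c : A) (E : {poly A}) :
  additive_over E -> additive_over (c%:P * E).
Proof.
rewrite /additive_over => addE; rewrite poly_XaYM addE !rmorphM /= map_polyC /=.
by rewrite /poly_XaY map_polyC /= comp_polyC mulrDr.
Qed.

Lemma additive_over_exp (A : comNzRingType) (E : {poly A}) q :
  (forall x y : {poly {poly A}}, (x + y) ^+ q = x ^+ q + y ^+ q) ->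
  additive_over E -> additive_over (E ^+ q).
Proof.
rewrite /additive_over => expD addE.
by rewrite poly_XaYXn addE expD !rmorphXn /=.
Qed.

(** * Degrees of additive polynomials and the characteristic exponent *)

(* The characteristic exponent: [q = 1] in characteristic zero. *)
Definition exp_char (k : fieldType) (q : nat) : Prop :=
  q \in [pchar k] \/ q = 1%N /\ [pchar k] =i pred0.

Lemma exp_char_exists (k : fieldType) : exists q, exp_char k q.
Proof.
case: (classic (exists p, p \in [pchar k])) => [[p kp] | k0].
  by exists p; left.
exists 1%N; right; split=> // p; rewrite inE; apply/negP => kp.
by apply: k0; exists p.
Qed.

Lemma exp_char_gt0 (k : fieldType) q : exp_char k q -> (0 < q)%N.
Proof. by case=> [/pcharf_prime/prime_gt0 | [-> _]]. Qed.

Lemma exp_char_exprD (k : fieldType) q (A : comNzRingType)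
    (f : {rmorphism k -> A}) j (x y : A) :
  exp_char k q -> (x + y) ^+ (q ^ j) = x ^+ (q ^ j) + y ^+ (q ^ j).
Proof.
case=> [/(rmorph_pchar f) pA | [-> _]]; last by rewrite exp1n !expr1.
elim: j => [|j IH]; first by rewrite !expr1.
by rewrite expnSr !exprM IH -!(pFrobenius_autE pA) rmorphD.
Qed.

Lemma coef_XaddC1_exp (A : nzRingType) N i :
  (('X + 1) ^+ N : {poly A})`_i = 'C(N, i)%:R.
Proof.
rewrite exprD1n coef_sum (eq_bigr (fun m : 'I_N.+1 =>
  if m == i :> nat then 'C(N, i)%:R else 0)) => [|m _]; last first.
  by rewrite coefMn coefXn eq_sym; case: eqP => [->|_]; rewrite ?mul0rn.
rewrite -big_mkcond /=; case: (leqP i N) => [leiN|ltNi].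
  by rewrite (big_pred1 (Ordinal (leiN : (i < N.+1)%N))).
by rewrite bin_small // big1.
Qed.

(** In characteristic zero, ['C(N, 1) = N] is non-zero, which forces [N = 1]. In characteristic [p],
    write [N = m * p ^ e] with [m] prime to [p]: since [(X + 1) ^ N] equals [(X ^ (p ^ e) + 1) ^ m],
    the binomial ['C(N, p ^ e)] is [m] in [k], non-zero, so [p ^ e < N] is impossible. *)
Lemma exp_char_bin0 (k : fieldType) q N :
  exp_char k q -> (0 < N)%N ->
  (forall i, (0 < i < N)%N -> 'C(N, i)%:R = 0 :> k) ->
  exists e, N = (q ^ e)%N.
Proof.
move=> kq N0 binN0; case: kq => [kp | [-> k0]]; last first.
  exists 0%N; case: N N0 binN0 => [|[|N]] // _ /(_ 1%N isT) /eqP.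
  rewrite bin1 => /(natf0_pchar (ltn0Sn _))[p].
  by rewrite k0.
have p_pr := pcharf_prime kp.
have [m pm DN] := pfactor_coprime p_pr N0.
set e := logn q N in DN; exists e.
have pe0 : (0 < q ^ e)%N by rewrite expn_gt0 prime_gt0.
case: m pm DN => [|[|m]] pm DN; [by rewrite DN in N0 | by rewrite DN mul1n |].
have lt_peN : (0 < q ^ e < N)%N by rewrite pe0 DN ltn_Pmull.
have /eqP := binN0 _ lt_peN; rewrite -coef_XaddC1_exp {1}DN mulnC exprM.
rewrite (exp_char_exprD (@polyC k) _ _ _ (or_introl kp)) expr1n.
rewrite -[X in X + 1]comp_polyX -[X in _ + X](comp_polyC _ 'X^(q ^ e)).
rewrite -comp_polyD -rmorphXn /= coef_comp_poly_Xn // dvdnn divnn pe0.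
rewrite coef_XaddC1_exp bin1 -(dvdn_pcharf kp) => pm0.
by move: pm; rewrite prime_coprime // pm0.
Qed.

(** For [q >= 2], an exponent strictly below the three others is excluded by divisibility by the
    next power of [q], and the remaining cases by size. It serves to compare degrees in a product of
    additive polynomials. *)
Lemma expn_add_eq q i j r s :
  (0 < q)%N -> (q ^ i + q ^ j = q ^ r + q ^ s)%N ->
  (q ^ i = q ^ r \/ q ^ i = q ^ s)%N.
Proof.
case: q => [|[|q]] // _; first by rewrite !exp1n; left.
set p := q.+2; have p1 : (1 < p)%N by [].
have lep x y : (x <= y)%N -> (p ^ x <= p ^ y)%N by move=> ?; rewrite leq_exp2l.
have ltp2 x y : (x < y)%N -> (p ^ x + p ^ x <= p ^ y)%N.
  move=> /lep; apply: leq_trans; rewrite expnS addnn -mul2n.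
  by rewrite leq_mul2r orbC.
have p0 x : (0 < p ^ x)%N by rewrite expn_gt0.
have ndvd x y z t : (x < y)%N -> (x < z)%N -> (x < t)%N ->
    (p ^ x + p ^ y)%N <> (p ^ z + p ^ t)%N.
  move=> xy xz xt e; have: (p ^ x.+1 %| p ^ x + p ^ y)%N.
    by rewrite e dvdn_add // dvdn_exp2l.
  by rewrite (dvdn_addl _ (dvdn_exp2l p xy)) dvdn_Pexp2l // ltnn.
wlog lers : r s / (r <= s)%N.
  move=> W; case/orP: (leq_total r s) => [/W // | /W W' e].
  by rewrite or_comm; apply: W'; rewrite e addnC.
move=> e; case: (ltngtP i r) => [ltir|ltri|->]; last by left.
  have ltis := leq_trans ltir lers.
  case: (ltnP i j) => [ltij|leji]; first by case: (ndvd i j r s).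
  have := ltp2 _ _ ltir; have := lep _ _ leji; have := p0 s; lia.
case: (ltngtP i s) => [ltis|ltsi|->]; last by right.
  case: (ltnP r j) => [ltrj|lejr].
    by case: (ndvd r s i j); rewrite // (leq_trans ltri (ltnW ltis)).
  have := ltp2 _ _ ltis; have := lep _ _ lejr; have := p0 i; have := p0 r; lia.
have := ltp2 _ _ ltsi; have := lep _ _ lers; have := p0 j; lia.
Qed.

(** Additivity multiplies the leading coefficient by each inner binomial of the degree and gives
    zero. As [A] is a domain, these binomials vanish in [k]. *)
Lemma additive_over_size (k : fieldType) q (A : idomainType)
    (f : {rmorphism k -> A}) (E : {poly A}) :
  exp_char k q -> additive_over E -> E != 0 ->
  exists e, size E = (q ^ e).+1.
Proof.
move=> kq addE E0; have sE0 : (0 < size E)%N by rewrite size_poly_gt0.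
have lc0 : lead_coef E != 0 by rewrite lead_coef_eq0.
have N0 : (0 < (size E).-1)%N.
  case: posnP => // N0; move: lc0.
  by rewrite lead_coefE N0 additive_over_coef0 ?eqxx.
have [i /andP[i0 ltiN]|e De] := exp_char_bin0 kq N0; last first.
  by exists e; rewrite -De prednK.
have := additive_over_bin addE i0 (_ : 0 < (size E).-1 - i)%N.
rewrite subn_gt0 subnKC ?(ltnW ltiN) // -lead_coefE => /(_ ltiN)/eqP.
rewrite -[_ *+ _]mulr_natl mulf_eq0 (negPf lc0) orbF => /eqP C0.
by apply: (fmorph_inj f); rewrite rmorph_nat rmorph0.
Qed.

(** * Proportional pairs of additive polynomials over a field *)

Lemma additive_overZ (k : fieldType) (c : k) (E : {poly k}) :
  additive_over E -> additive_over (c *: E).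
Proof. by rewrite -mul_polyC; apply: additive_overMC. Qed.

Lemma additive_overB (k : fieldType) (E F : {poly k}) :
  additive_over E -> additive_over F -> additive_over (E - F).
Proof.
move=> addE addF; apply: additive_overD => //.
by rewrite -scaleN1r; apply: additive_overZ.
Qed.

Lemma size_sub_lead (k : fieldType) (a b : {poly k}) :
  a != 0 -> size b = size a ->
  (size (b - (lead_coef b / lead_coef a) *: a)%R < size a)%N.
Proof.
move=> a0 sb; set m := _ / _; set r := b - _.
have lca : lead_coef a != 0 by rewrite lead_coef_eq0.
have s0 : (0 < size a)%N by rewrite size_poly_gt0.
rewrite -(prednK s0) ltnS; apply/leq_sizeP => j.
rewrite leq_eqVlt => /orP[/eqP<-|ltj].
  by rewrite coefB coefZ -{1}sb -!lead_coefE divfK // subrr.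
rewrite (prednK s0) in ltj.
by rewrite coefB coefZ !nth_default ?sb // mulr0 subr0.
Qed.

Section Proportional.
Variables (k : fieldType) (q : nat) (a : {poly k}).
Hypotheses (kq : exp_char k q) (adda : additive_over a).

Definition free_pair (b : {poly k}) : Prop :=
  forall x y : k, x *: a + y *: b = 0 -> x = 0 /\ y = 0.

(** The four degrees are powers of [q], and the two products have equal degree, so the degree of [a]
    is that of [a'] or that of [b]. The second case is removed beforehand. *)
Lemma additive_ratio_size (b a' b' : {poly k}) :
  additive_over b -> free_pair b -> additive_over a' ->
  additive_over b' -> a * b' = a' * b ->
  a' != 0 -> size a' = size a.
Proof.
move=> addb free_ab; have a0 : a != 0.
  apply/eqP=> Ea; have [] := free_ab _ _ (_ : 1 *: a + 0 *: b = 0).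
    by rewrite Ea scaler0 scale0r addr0.
  by move/eqP; rewrite oner_eq0.
move=> adda' addb' e a'0.
(* Subtracting [m *: a] from [b] and [m *: a'] from [b'] preserves all hypotheses and lowers the
   degree of [b] below that of [a]. *)
wlog nes : b b' addb free_ab addb' e / size b != size a.
  move=> W; case: (eqVneq (size b) (size a)) => [sba|nes]; last exact: (W b b').
  pose m := lead_coef b / lead_coef a.
  apply: (W (b - m *: a) (b' - m *: a')).
  - by apply: additive_overB => //; apply: additive_overZ.
  - move=> x y; rewrite scalerBr scalerA => H.
    have [] := free_ab _ _ (_ : (x - y * m) *: a + y *: b = 0).
      by rewrite scalerBl addrAC -addrA.
    by move=> xm y0; move: xm; rewrite y0 mul0r subr0.
  - by apply: additive_overB => //; apply: additive_overZ.
  - by rewrite !mulrBr e -!scalerAr [a * a']mulrC.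
  - by rewrite neq_ltn size_sub_lead.
have b0 : b != 0.
  apply/eqP=> Eb; have [] := free_ab _ _ (_ : 0 *: a + 1 *: b = 0).
    by rewrite Eb scaler0 scale0r addr0.
  by move=> _ /eqP; rewrite oner_eq0.
have b'0 : b' != 0.
  by apply: contra_neq (mulf_neq0 a'0 b0) => b'0; rewrite -e b'0 mulr0.
have sz := additive_over_size idfun kq.
have [[i Da] [j Db] [i' Da'] [j' Db']] := And4 (sz _ adda a0)
  (sz _ addb b0) (sz _ adda' a'0) (sz _ addb' b'0).
have := congr1 (size \o @polyseq k) e; rewrite /= !size_mul // Da Db Da' Db'.
rewrite !addSn !addnS /= => -[/(expn_add_eq (exp_char_gt0 kq))[->//|eij]].
by rewrite Da Db eij eqxx in nes.
Qed.

(** With [x] the ratio of the leading coefficients, [a' - x *: a] and [b' - x *: b] satisfy the same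
    relation. The first has degree below that of [a], which [additive_ratio_size] allows only if it
    is zero. *)
Lemma additive_ratio_const (b a' b' : {poly k}) :
  additive_over b -> free_pair b -> additive_over a' ->
  additive_over b' -> a * b' = a' * b ->
  exists x : k, a' = x *: a /\ b' = x *: b.
Proof.
move=> addb free_ab adda' addb' e.
have a0 : a != 0.
  apply/eqP=> Ea; have [] := free_ab _ _ (_ : 1 *: a + 0 *: b = 0).
    by rewrite Ea scaler0 scale0r addr0.
  by move/eqP; rewrite oner_eq0.
pose x := lead_coef a' / lead_coef a; exists x.
have Ea' : a' - x *: a = 0.
  case: (eqVneq a' 0) => [a'0|a'0].
    by rewrite /x a'0 lead_coef0 mul0r scale0r subr0.
  have sa' := additive_ratio_size addb free_ab adda' addb' e a'0.
  apply/eqP; apply: contraT => d0.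
  have := size_sub_lead a0 sa'; rewrite -/x.
  rewrite (@additive_ratio_size b _ (b' - x *: b)) ?ltnn //.
  - by apply: additive_overB => //; apply: additive_overZ.
  - by apply: additive_overB => //; apply: additive_overZ.
  - by rewrite mulrBr mulrBl e -scalerAr -scalerAl.
have Eb' : a * (b' - x *: b) = 0.
  by rewrite mulrBr e -scalerAr scalerAl -mulrBl Ea' mul0r.
move/eqP: Eb'; rewrite mulf_eq0 (negPf a0) subr_eq0 => /eqP.
by move/eqP: Ea'; rewrite subr_eq0 => /eqP.
Qed.

End Proportional.

(** * Linear forms with coefficients in [k[t]], and their primality *)

Lemma mpoly_subring_ind (k : fieldType) n (Q : {mpoly k[n]} -> Prop) :
  (forall p q, Q p -> Q q -> Q (p + q)) ->
  (forall p q, Q p -> Q q -> Q (p * q)) ->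
  (forall c : k, Q c%:MP) -> (forall j, Q 'X_j) ->
  forall p, Q p.
Proof.
move=> QD QM QC QX; elim/mpolyind => [|c m f _ _ Qf].
  by rewrite -mpolyC0.
apply: (QD) => //; rewrite -mul_mpolyC; apply: (QM) => //.
have Q1 : Q 1 by rewrite -mpolyC1.
rewrite mpolyXE_id; apply: (big_ind Q) => [||j _]; [exact: Q1 | exact: QM |].
by elim: (m j) => [|e IH]; rewrite ?expr0 // exprS; apply: QM.
Qed.

Section LinearForms.
Variables (k : fieldType) (n : nat).
Local Notation R := {mpoly k[n]}.
Local Notation "c ^M" := (map_poly (@mpolyC n k) c)
  (at level 2, format "c ^M").

Definition linear_form (a : 'I_n -> {poly k}) : {poly R} :=
  \sum_(j < n) (a j)^M * ('X_j)%:P.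

Lemma linear_form_coef a N : (linear_form a)`_N = \sum_(j < n) (a j)`_N *: 'X_j.
Proof.
rewrite coef_sum; apply: eq_bigr => j _.
by rewrite coefMC coef_map mul_mpolyC.
Qed.

Lemma linear_form_eq0 a : linear_form a = 0 -> forall j, a j = 0.
Proof.
move=> a0 j; apply/polyP=> N.
have /(congr1 (mcoeff U_(j))) := linear_form_coef a N.
rewrite a0 !coef0 mcoeff0 raddf_sum /= (bigD1 j) //= mcoeffZ mcoeffXU eqxx.
rewrite mulr1 big1 ?addr0 // => i neij.
by rewrite mcoeffZ mcoeffXU (negPf neij) mulr0.
Qed.

Lemma linear_formD a b : linear_form (fun j => a j + b j) =
  linear_form a + linear_form b.
Proof.
by rewrite -big_split; apply: eq_bigr => j _; rewrite rmorphD mulrDl.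
Qed.

Lemma linear_formM c a : linear_form (fun j => c * a j) = c^M * linear_form a.
Proof.
by rewrite mulr_sumr; apply: eq_bigr => j _; rewrite rmorphM mulrA.
Qed.

Lemma mpoly_poly_subring (Q : {poly R} -> Prop) :
  (forall p q, Q p -> Q q -> Q (p + q)) ->
  (forall p q, Q p -> Q q -> Q (p * q)) ->
  (forall c : k, Q (c%:MP)%:P) -> (forall j, Q ('X_j)%:P) -> Q 'X ->
  forall p, Q p.
Proof.
move=> QD QM QC QXj QX.
have QR (f : R) : Q f%:P.
  elim/mpoly_subring_ind: f => [f g Qf Qg|f g Qf Qg|//|//].
    by rewrite polyCD; apply: QD.
  by rewrite polyCM; apply: QM.
elim/poly_ind => [|p c Qp]; first by rewrite -polyC0.
by apply: (QD) => //; apply: (QM).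
Qed.

Lemma poly_mpoly_subst (S : comNzRingType) (f : {rmorphism {poly R} -> S})
    (rho : 'I_n -> S) :
  exists sigma : {rmorphism {poly R} -> S},
    [/\ sigma 'X = f 'X, forall x : k, sigma (x%:MP)%:P = f (x%:MP)%:P
      & forall j, sigma ('X_j)%:P = rho j].
Proof.
pose phi : {rmorphism R -> S} := mmap (f \o (polyC \o @mpolyC n k)) rho.
have cXphi : commr_rmorph phi (f 'X) by move=> x; apply: mulrC.
exists (horner_morph cXphi); split=> [|x|j] /=.
- by rewrite horner_morphX.
- by rewrite horner_morphC /phi /= mmapC.
- by rewrite horner_morphC /phi /= mmapX mmap1U.
Qed.

(* Substituting ['X_i - linear_form a / (a i)^M] for ['X_i] kills [linear_form a]
   but not [linear_form b], hence kills [F]; and each polynomial is congruent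
   to its image modulo [linear_form a], up to powers of [(a i)^M]. *)
Lemma linear_form_prime_pivot (a b : 'I_n -> {poly k}) i j (F G : {poly R}) :
  a i != 0 -> a i * b j != a j * b i ->
  F * linear_form b = G * linear_form a ->
  exists (d : {poly k}) (H : {poly R}),
    d != 0 /\ d^M * F = linear_form a * H.
Proof.
move=> ai0 det FG.
have [la Dla] : exists la, la = linear_form a by exists (linear_form a).
have [c Dc] : exists c, c = (a i)^M by exists (a i)^M.
rewrite -Dla in FG *.
have [tf tf0] : exists tf : {rmorphism {poly R} -> {fraction {poly R}}},
    forall x, (tf x == 0) = (x == 0).
  by exists (@tofrac {poly R}) => x; rewrite tofrac_eq0.
have c0 : tf c != 0 by rewrite tf0 Dc map_poly_eq0.
have [sigma [sX sC sXj]] := poly_mpoly_subst tf (fun l =>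
  tf ('X_l)%:P - (if l == i then tf la / tf c else 0)).
have sM (d : {poly k}) : sigma d^M = tf d^M.
  elim/poly_ind: d => [|p x IH]; first by rewrite !rmorph0.
  rewrite !(rmorphD, rmorphM) /= map_polyX map_polyC /= IH sX sC.
  by rewrite -rmorphM -rmorphD.
have sL e : sigma (linear_form e) =
    tf (linear_form e) - tf (e i)^M * (tf la / tf c).
  rewrite !rmorph_sum /= (eq_bigr (fun l => tf ((e l)^M * ('X_l)%:P) -
    (if l == i then tf (e i)^M * (tf la / tf c) else 0))) => [|l _].
    by rewrite sumrB -big_mkcond big_pred1_eq.
  rewrite !rmorphM /= sM sXj mulrBr.
  by case: eqP => [->|_]; rewrite ?mulr0.
have sub_sigma f : exists N H, tf c ^+ N * (tf f - sigma f) = tf (la * H).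
  elim/mpoly_poly_subring: f => [p q [N1 [H1 e1]] [N2 [H2 e2]]|
                      p q [N1 [H1 e1]] [N2 [H2 e2]]|x|l|].
  - exists (N1 + N2)%N, (c ^+ N2 * H1 + c ^+ N1 * H2).
    have -> : la * (c ^+ N2 * H1 + c ^+ N1 * H2) =
      c ^+ N2 * (la * H1) + c ^+ N1 * (la * H2) by ring.
    rewrite !rmorphD !(rmorphM tf (_ ^+ _)) /= -e1 -e2 !rmorphXn /= exprD.
    ring.
  (* The witness comes from [pq - sigma p * sigma q = (p - sigma p) q + sigma p (q - sigma q)],
     where [c ^+ N1 * sigma p] is [c ^+ N1 * p - la * H1]. *)
  - exists (N1 + N2)%N, (H1 * (c ^+ N2 * q) + (c ^+ N1 * p - la * H1) * H2).
    have -> : la * (H1 * (c ^+ N2 * q) + (c ^+ N1 * p - la * H1) * H2) =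
      la * H1 * (c ^+ N2 * q) + (c ^+ N1 * p - la * H1) * (la * H2) by ring.
    rewrite rmorphD (rmorphM _ (la * H1)) (rmorphM _ _ (la * H2)) rmorphB /=.
    rewrite -e1 -e2 !rmorphM !rmorphXn /= exprD.
    ring.
  - by exists 0%N, 0; rewrite sC subrr !mulr0 rmorph0.
  - rewrite sXj; case: eqP => _; last first.
      by exists 0%N, 0; rewrite subr0 subrr !mulr0 rmorph0.
    exists 1%N, 1; rewrite expr1 mulr1 opprB addrC subrK mulrC divfK //.
  - by exists 0%N, 0; rewrite sX subrr !mulr0 rmorph0.
have sla : sigma la = 0 by rewrite Dla sL -Dla -Dc mulrC divfK // subrr.
(* If [sigma] killed [linear_form b], then [a i] times this form would be [b i] times [la]; the
   coefficients of ['X_j] would contradict [det]. *)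
have slb : sigma (linear_form b) != 0.
  apply: contra_neq det => slb0.
  have lin0 : linear_form (fun l => a i * b l + - b i * a l) = 0.
    rewrite linear_formD !linear_formM -Dc -Dla; apply/eqP; rewrite -tf0.
    rewrite rmorphD !rmorphM /= rmorphN.
    move/eqP: slb0; rewrite sL subr_eq0 => /eqP->.
    by rewrite rmorphN mulNr mulrCA [tf c * _]mulrC divfK // subrr.
  have := linear_form_eq0 lin0 j; rewrite mulNr => /eqP.
  by rewrite subr_eq0 mulrC [X in _ == X]mulrC => /eqP.
have [N [H]] := sub_sigma F.
have -> : sigma F = 0.
  have /eqP := congr1 sigma FG; rewrite !rmorphM /= sla mulr0 mulf_eq0.
  by rewrite (negPf slb) orbF => /eqP.
rewrite subr0 -rmorphXn -rmorphM /= => /eqP.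
rewrite -subr_eq0 -rmorphB tf0 subr_eq0 => /eqP e.
exists (a i ^+ N), H; split; first by rewrite expf_neq0.
by rewrite rmorphXn /= -Dc.
Qed.

(** The non-zero minor makes [a i] or [a j] non-zero, and that entry serves as the pivot. *)
Lemma linear_form_prime (a b : 'I_n -> {poly k}) i j (F G : {poly R}) :
  a i * b j != a j * b i ->
  F * linear_form b = G * linear_form a ->
  exists (d : {poly k}) (H : {poly R}),
    d != 0 /\ d^M * F = linear_form a * H.
Proof.
move=> det; case: (eqVneq (a i) 0) => [ai0|]; last first.
  by move/linear_form_prime_pivot; apply; apply: det.
apply: (@linear_form_prime_pivot _ _ j i); last by rewrite eq_sym.
by apply: contra_neq det => aj0; rewrite ai0 aj0 !mul0r.
Qed.

End LinearForms.

(** * Divisors of a product of a polynomial in [t] and an element free of [t] *)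

Section Split.
Variables (k : closedFieldType) (n : nat).
Local Notation R := {mpoly k[n]}.
Local Notation "c ^M" := (map_poly (@mpolyC n k) c)
  (at level 2, format "c ^M").

(** A root of [d] in [k] is a root of [F] or of [E], so its linear factor can be cancelled; those
    taken from [E] make up [c]. Once [d] is constant, degrees in [t] leave [E] constant as well. *)
Lemma dvd_poly_const_split (d : {poly k}) (h : R) (F E : {poly R}) :
  d != 0 -> h != 0 -> d^M * h%:P = F * E ->
  exists (c : {poly k}) (e : R), E = c^M * e%:P.
Proof.
elim: {d}(size d) {-2}d (leqnn (size d)) F E => [|s IH] d.
  by rewrite leqn0 size_poly_eq0 => ->.
move=> sd F E d0 h0 dhE.
have dM0 : d^M != 0 by rewrite map_poly_eq0.
have hP0 : h%:P != 0 :> {poly R} by rewrite polyC_eq0.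
have FE0 : F * E != 0 by rewrite -dhE mulf_neq0.
have [F0 E0] : F != 0 /\ E != 0 
  by apply/andP; rewrite -negb_or -mulf_eq0.
case: (eqVneq (size d) 1%N) => [sd1|/closed_rootP[x /factor_theorem[d' Dd]]].
  have := congr1 (size \o @polyseq R) dhE.
  rewrite /= size_mul // size_map_poly sd1 size_polyC h0 /= size_mul //.
  have sF : (0 < size F)%N by rewrite size_poly_gt0.
  have sE : (0 < size E)%N by rewrite size_poly_gt0.
  move=> e; have /size_poly1P[y _ ->] : size E == 1%N.
    by move: (size F) (size E) sF sE e => x y; lia.
  by exists 1, y; rewrite rmorph1 mul1r.
have DdM : d^M = d'^M * ('X - (x%:MP)%:P).
  by rewrite Dd rmorphM rmorphB /= map_polyX map_polyC.
have d'0 : d' != 0 by apply: contra_neq d0 => d'0; rewrite Dd d'0 mul0r.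
have sd' : (size d' <= s)%N.
  by move: sd; rewrite Dd size_Mmonic ?monicXsubC // size_XsubC addn2.
have nzX : 'X - (x%:MP)%:P != 0 :> {poly R} by rewrite polyXsubC_eq0.
have : root (F * E) x%:MP by rewrite -dhE DdM !rootM root_XsubC eqxx orbT.
rewrite rootM => /orP[/factor_theorem[F' DF] | /factor_theorem[E' DE]].
  apply: (IH d' sd' F' E) => //; apply: (mulIf nzX).
  by rewrite mulrAC -DdM dhE DF mulrAC.
have [|c [e De]] := IH d' sd' F E' d'0 h0.
  by apply: (mulIf nzX); rewrite mulrAC -DdM dhE DE mulrA.
exists (c * ('X - x%:P)), e.
by rewrite DE De rmorphM rmorphB /= map_polyX map_polyC mulrAC.
Qed.

End Split.

(** * Additive translates and their Euclidean division *)

Section Translates.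
Variables (k : fieldType) (A : idomainType) (f : {rmorphism k -> A}).
Variables (b : {rmorphism A -> {poly A}}) (q : nat).
Hypothesis kq : exp_char k q.

(** Candidates for pairs: a translate that factors as [c(t) h] yields one. Stability under sums,
    invariant multiples and powers [q ^ j] is what makes division possible. *)
Definition translate (E : {poly A}) : Prop :=
  [/\ forall i, b E`_i = (E`_i)%:P, additive_over E
    & exists g, b g = g%:P + E].

Lemma translateD (E F : {poly A}) :
  translate E -> translate F -> translate (E + F).
Proof.
case=> [Ei Ea [g Dg]] [Fi Fa [h Dh]]; split.
- by move=> i; rewrite coefD rmorphD Ei Fi polyCD.
- exact: additive_overD.
- by exists (g + h); rewrite rmorphD Dg Dh polyCD addrACA.
Qed.

Lemma translateMC (c : A) (E : {poly A}) :
  b c = c%:P -> translate E -> translate (c%:P * E).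
Proof.
move=> bc [Ei Ea [g Dg]]; split.
- by move=> i; rewrite coefCM rmorphM Ei bc polyCM.
- exact: additive_overMC.
- by exists (c * g); rewrite rmorphM Dg bc polyCM mulrDr.
Qed.

Lemma invariant_exp (E : {poly A}) m :
  (forall i, b E`_i = (E`_i)%:P) -> forall i, b (E ^+ m)`_i = ((E ^+ m)`_i)%:P.
Proof.
move=> Ei; elim: m => [|m IH] i.
  by rewrite expr0 coef1; case: (i == 0)%N; rewrite ?rmorph1 ?rmorph0.
rewrite exprS coefM !rmorph_sum; apply: eq_bigr => j _ /=.
by rewrite !rmorphM /= Ei IH.
Qed.

Lemma translate_exp (E : {poly A}) j : translate E -> translate (E ^+ (q ^ j)).
Proof.
case=> [Ei Ea [g Dg]]; split.
- exact: invariant_exp.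
- apply: additive_over_exp => // x y.
  exact: (exp_char_exprD (polyC \o (polyC \o f))).
- exists (g ^+ (q ^ j)).
  by rewrite rmorphXn Dg (exp_char_exprD (polyC \o f)) // rmorphXn.
Qed.

(* Euclidean division by [E]: the degrees of [E] and [C] are powers of [q], so
   a power [E ^+ (q ^ j)], again a translate, has the degree of [C]. *)
Lemma translate_min_dvd (E : {poly A}) :
  translate E -> E != 0 ->
  (forall F, translate F -> F != 0 -> (size E <= size F)%N) ->
  forall C, translate C -> exists (h : A) (Q : {poly A}),
    h != 0 /\ h%:P * C = Q * E.
Proof.
move=> tE E0 Emin C.
elim: {C}(size C) {-2}C (leqnn (size C)) => [|s IH] C sC tC.
  move: sC; rewrite leqn0 size_poly_eq0 => /eqP->.
  by exists 1, 0; rewrite oner_eq0 mulr0 mul0r.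
case: (eqVneq C 0) => [->|C0].
  by exists 1, 0; rewrite oner_eq0 mulr0 mul0r.
have [e sE] : exists e, size E = (q ^ e).+1.
  by case: tE => _ aE _; apply: (additive_over_size f kq aE E0).
have [a sCa] : exists a, size C = (q ^ a).+1.
  by case: tC => _ aC _; apply: (additive_over_size f kq aC C0).
have q0 := exp_char_gt0 kq.
have [j qj] : exists j, (q ^ a = q ^ e * q ^ j)%N.
  case: (leqP e a) => [lea|lta].
    by exists (a - e)%N; rewrite -expnD subnKC.
  (* Although [a < e], minimality of [E] gives [q ^ e <= q ^ a], so both powers agree; this is the
     case [q = 1]. *)
  exists 0%N; rewrite muln1; apply/eqP; rewrite eqn_leq.
  rewrite leq_pexp2l //; last exact: ltnW.
  by have := Emin C tC C0; rewrite sE sCa ltnS.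
set F := E ^+ (q ^ j); have tF : translate F by apply: translate_exp.
have F0 : F != 0 by rewrite expf_neq0.
have sF : size F = size C.
  by rewrite sCa qj -[LHS]prednK ?size_poly_gt0 // size_exp sE.
have lF0 : lead_coef F != 0 by rewrite lead_coef_eq0.
(* The leading terms cancel, and the multipliers are invariant, so the remainder is again a
   translate. *)
pose C' := (lead_coef F)%:P * C + (- lead_coef C)%:P * F.
have inv_lead G : translate G -> b (lead_coef G) = (lead_coef G)%:P.
  by case=> Gi _ _; apply: Gi.
have tC' : translate C'.
  apply: translateD; apply: translateMC => //; first exact: inv_lead.
  by rewrite rmorphN inv_lead // polyCN.
have sC' : (size C' <= s)%N.
  apply/leq_sizeP => i lesi; rewrite coefD !coefCM.
  case: (ltnP i (size C)) => [ltiC|leCi]; last first.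
    by rewrite !nth_default ?sF // !mulr0 addr0.
  have -> : i = (size C).-1 by lia.
  by rewrite -{2}sF -!lead_coefE mulNr mulrC subrr.
have [h [Q [h0 e']]] := IH C' sC' tC'.
exists (h * lead_coef F), (Q + (h * lead_coef C)%:P * E ^+ (q ^ j).-1).
split; first by rewrite mulf_neq0.
have qj0 : (0 < q ^ j)%N by rewrite expn_gt0 q0.
rewrite mulrDl -e' /C' -mulrA -exprSr prednK // -/F !polyCM polyCN.
ring.
Qed.

End Translates.

(** * The coefficient matrices of the representation and their action on linear forms *)

Section Coaction.
Variables (k : fieldType) (n : nat) (M : Ga_rep k n).
Local Notation R := {mpoly k[n]}.
Local Notation "c ^M" := (map_poly (@mpolyC n k) c)
  (at level 2, format "c ^M").

Lemma coactionD (p q : R) : coaction M (p + q) = coaction M p + coaction M q.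
Proof. exact: (rmorphD (coaction M)). Qed.

Lemma coactionM (p q : R) : coaction M (p * q) = coaction M p * coaction M q.
Proof. exact: (rmorphM (coaction M)). Qed.

Lemma coaction_sum (I : finType) (F : I -> R) :
  coaction M (\sum_i F i) = \sum_i coaction M (F i).
Proof. exact: (rmorph_sum (coaction M)). Qed.

Lemma coactionC (c : k) : coaction M c%:MP = (c%:MP)%:P.
Proof. by rewrite /coaction mmapC. Qed.

Definition coef_mx N : 'M[k]_n := \matrix_(i, j) (M i j)`_N.

Lemma coef_mxM a b : coef_mx a *m coef_mx b = coef_mx (a + b) *+ 'C(a + b, a).
Proof.
apply/matrixP=> i j; rewrite mxE mulmxnE mxE -coef_poly_XaY.
have /matrixP/(_ i j) := rep_mxD M; rewrite !mxE => ->.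
rewrite !coef_sum; apply: eq_bigr => l _.
by rewrite !mxE coefMC coef_map /= coefCM.
Qed.

(** The group law makes this matrix idempotent, and it is invertible as the value of [M] at
    [t = 0]. *)
Lemma coef_mx0 : coef_mx 0 = 1%:M.
Proof.
have U : coef_mx 0 \in unitmx.
  have -> : coef_mx 0 = map_mx (horner_eval 0) M.
    by apply/matrixP=> i j; rewrite !mxE /horner_eval horner_coef0.
  by rewrite unitmxE det_map_mx rmorph_unit // -unitmxE rep_mx_unit.
have := coef_mxM 0 0; rewrite bin0 mulr1n.
by move/(congr1 (mulmx (invmx (coef_mx 0)))); rewrite mulKmx // mulVmx.
Qed.

Lemma coef_mx_comm a b : coef_mx a *m coef_mx b = coef_mx b *m coef_mx a.
Proof.
by rewrite !coef_mxM [(b + a)%N]addnC -[in RHS]bin_sub ?leq_addl // addnK.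
Qed.

Lemma coef_mx_bounded : exists d, forall N, (d <= N)%N -> coef_mx N = 0.
Proof.
exists (\max_(ij : 'I_n * 'I_n) size (M ij.1 ij.2))%N => N ledN.
apply/matrixP=> i j; rewrite !mxE nth_default //; apply: leq_trans ledN.
exact: (leq_bigmax (i, j)).
Qed.

(** Row vectors stand for elements of the dual space, so that the co-action becomes right
    multiplication by the matrices [coef_mx N]. *)
Definition lform (u : 'rV[k]_n) : R := \sum_(j < n) u 0 j *: 'X_j.

Lemma lformD u v : lform (u + v) = lform u + lform v.
Proof. by rewrite -big_split; apply: eq_bigr => j _; rewrite mxE scalerDl. Qed.

Lemma lformZ c u : lform (c *: u) = c *: lform u.
Proof. by rewrite scaler_sumr; apply: eq_bigr => j _; rewrite mxE scalerA. Qed.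

Lemma lform0 : lform 0 = 0.
Proof. by rewrite -(scale0r 0) lformZ scale0r. Qed.

Lemma lform_delta j : lform (delta_mx 0 j) = 'X_j.
Proof.
rewrite /lform (bigD1 j) //= mxE !eqxx scale1r big1 ?addr0 // => i nij.
by rewrite mxE (negPf nij) andbF scale0r.
Qed.

Lemma lform_eq0 u : lform u = 0 -> u = 0.
Proof.
move=> u0; apply/rowP=> j; rewrite mxE.
have /(congr1 (mcoeff U_(j))) := u0.
rewrite mcoeff0 raddf_sum /= (bigD1 j) //= mcoeffZ mcoeffXU eqxx mulr1.
rewrite big1 ?addr0 // => i nij.
by rewrite mcoeffZ mcoeffXU (negPf nij) mulr0.
Qed.

Lemma lform_homog u : lform u \is 1.-homog.
Proof.
by apply: rpred_sum => j _; apply: rpredZ; rewrite dhomogX /= mdeg1.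
Qed.

Lemma coaction_lform_coef u N : (coaction M (lform u))`_N =
  lform (u *m coef_mx N).
Proof.
have coefX i : (coaction M 'X_i)`_N = \sum_(j < n) coef_mx N i j *: 'X_j.
  rewrite /coaction mmapX mmap1U coef_sum; apply: eq_bigr => j _.
  by rewrite coefMC coef_map mul_mpolyC mxE.
rewrite /lform coaction_sum coef_sum.
rewrite (eq_bigr (fun i => \sum_(j < n) (u 0 i * coef_mx N i j) *: 'X_j)).
  rewrite exchange_big; apply: eq_bigr => j _ /=.
  by rewrite mxE scaler_suml.
move=> i _; rewrite -mul_mpolyC coactionM coactionC.
rewrite coefCM coefX mul_mpolyC scaler_sumr.
by apply: eq_bigr => j _; rewrite scalerA.
Qed.

Definition fixed (u : 'rV[k]_n) : Prop :=
  forall N, (0 < N)%N -> u *m coef_mx N = 0.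

Lemma coaction_lform_fixed u :
  fixed u -> Ga_invariant (coaction M) (lform u).
Proof.
move=> fu; apply/polyP=> -[|N]; rewrite coaction_lform_coef coefC /=.
  by rewrite coef_mx0 mulmx1.
by rewrite fu // lform0.
Qed.

(** These are the entries of [u M(t) - u]; their [linear_form] is what the co-action adds to
    [lform u]. *)
Definition moving_part (u : 'rV[k]_n) (j : 'I_n) : {poly k} :=
  \sum_(i < n) u 0 i *: M i j - (u 0 j)%:P.

Lemma coef_moving_part u j N :
  (moving_part u j)`_N = if N == 0%N then 0 else (u *m coef_mx N) 0 j.
Proof.
have e : (\sum_(i < n) u 0 i *: M i j)`_N = (u *m coef_mx N) 0 j.
  by rewrite coef_sum mxE; apply: eq_bigr => i _; rewrite coefZ mxE.
rewrite coefB e coefC; case: eqP => [->|_]; last by rewrite subr0.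
by rewrite coef_mx0 mulmx1 subrr.
Qed.

Lemma moving_part_coef u N : (0 < N)%N ->
  (linear_form (moving_part u))`_N = lform (u *m coef_mx N).
Proof.
move=> N0; rewrite linear_form_coef; apply: eq_bigr => j _.
by rewrite coef_moving_part gtn_eqF.
Qed.

Lemma moving_part_coef0 u : (linear_form (moving_part u))`_0 = 0.
Proof.
rewrite linear_form_coef big1 // => j _.
by rewrite coef_moving_part scale0r.
Qed.

Lemma coaction_lform u :
  coaction M (lform u) = (lform u)%:P + linear_form (moving_part u).
Proof.
apply/polyP=> -[|N]; rewrite coaction_lform_coef coefD coefC /=.
  by rewrite moving_part_coef0 coef_mx0 mulmx1 addr0.
by rewrite moving_part_coef // add0r.
Qed.

(** For [a, b > 0], the product [u M_a M_b] vanishes and equals ['C(a + b, a)] times [u M_(a + b)]: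
    this is additivity. Invariance of the coefficients is the hypothesis itself. *)
Lemma moving_part_translate u :
  (forall a, (0 < a)%N -> fixed (u *m coef_mx a)) ->
  translate (coaction M) (linear_form (moving_part u)).
Proof.
move=> u2; split.
- case=> [|N]; first by rewrite moving_part_coef0 rmorph0.
  by rewrite moving_part_coef //; apply: coaction_lform_fixed; apply: u2.
- apply: additive_overI => [|a b a0 b0]; first exact: moving_part_coef0.
  rewrite moving_part_coef ?addn_gt0 ?a0 // -scaler_nat -lformZ scaler_nat.
  by rewrite -raddfMn /= -coef_mxM mulmxA u2 // lform0.
- by exists (lform u); apply: coaction_lform.
Qed.

Lemma moving_part_eq0 u : (forall j, moving_part u j = 0) -> fixed u.
Proof.
move=> u0 N N0; apply/rowP=> j; rewrite [RHS]mxE.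
by have := coef_moving_part u j N; rewrite gtn_eqF // u0 coef0.
Qed.

Lemma moving_partD x y u v j :
  moving_part (x *: u + y *: v) j = x *: moving_part u j + y *: moving_part v j.
Proof.
apply/polyP=> N; rewrite coef_moving_part coefD !coefZ !coef_moving_part.
case: eqP => _; first by rewrite !mulr0 addr0.
by rewrite mulmxDl -!scalemxAl !mxE.
Qed.

(** Take the largest [i] with [u M_i] outside [S], which exists since [M] is polynomial in [t]; then
    [u M_i M_j] is a multiple of [u M_(i + j)], which lies in [S]. This provides vectors fixed
    modulo [S]. *)
Lemma exists_last_outside (S : 'M[k]_n) (u : 'rV[k]_n) :
  ~~ (u <= S)%MS ->
  exists i, ~~ (u *m coef_mx i <= S)%MS /\
    forall j, (0 < j)%N -> (u *m coef_mx i *m coef_mx j <= S)%MS.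
Proof.
move=> uS; have [d Md0] := coef_mx_bounded.
have ex0 : exists i, ~~ (u *m coef_mx i <= S)%MS.
  by exists 0%N; rewrite coef_mx0 mulmx1.
have bd i : ~~ (u *m coef_mx i <= S)%MS -> (i <= d)%N.
  by apply: contraNT; rewrite -ltnNge => /ltnW/Md0->; rewrite mulmx0 sub0mx.
case: (ex_maxnP ex0 bd) => i ui maxi; exists i; split=> // j j0.
rewrite -mulmxA coef_mxM -scaler_nat -scalemxAr scalemx_sub //.
by apply: contraT => /maxi; rewrite -{2}[i]addn0 leq_add2l leqNgt j0.
Qed.

Lemma fixed_mx : exists B : 'M[k]_n, forall u : 'rV[k]_n,
  (u <= B)%MS <-> fixed u.
Proof.
have [d Md0] := coef_mx_bounded.
exists (\bigcap_(N < d) kermx (coef_mx N.+1))%MS => u.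
split=> [/sub_bigcapmxP uB|fu].
  case=> // N _; case: (ltnP N d) => [ltNd|ledN].
    by apply/sub_kermxP; apply: (uB (Ordinal ltNd)).
  by rewrite Md0 ?mulmx0 // leqW.
by apply/sub_bigcapmxP => N _; apply/sub_kermxP; apply: fu.
Qed.

End Coaction.

(** * Producing non-zero pairs from linear forms *)

Section Pairs.
Variables (k : closedFieldType) (n : nat) (M : Ga_rep k n).
Local Notation R := {mpoly k[n]}.
Local Notation "c ^M" := (map_poly (@mpolyC n k) c)
  (at level 2, format "c ^M").

(** Making [c] monic turns [h] into a coefficient of the translate, hence an invariant. Additivity
    passes from the product to [c] because [e] is non-zero. *)
Lemma is_pairI (c : {poly k}) (e : R) :
  c != 0 -> e != 0 -> translate (coaction M) (c^M * e%:P) ->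
  exists h : R, large_pedestal_gen (coaction M) h /\ h != 0.
Proof.
move=> c0 e0 [Ei Ea [g Dg]].
have lc0 : lead_coef c != 0 by rewrite lead_coef_eq0.
pose d := (lead_coef c)^-1 *: c; pose h := lead_coef c *: e.
have Dch : c^M * e%:P = d^M * h%:P.
  rewrite /d /h -mul_polyC rmorphM /= map_polyC -mul_mpolyC polyCM mulrACA.
  by rewrite -polyCM -mpolyCM mulVf // mpolyC1 mul1r.
have coefE N : (c^M * e%:P)`_N = c`_N *: e.
  by rewrite coefMC coef_map mul_mpolyC.
exists h; split; last by rewrite scaler_eq0 negb_or lc0.
exists d, g; split.
- by rewrite scaler_eq0 negb_or invr_eq0 lc0.
- apply: additive_overZ; apply: additive_overI => [|i j i0 j0].
    have /eqP := additive_over_coef0 Ea.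
    by rewrite coefE scaler_eq0 (negPf e0) orbF => /eqP.
  have /eqP := additive_over_bin Ea i0 j0.
  by rewrite coefE scalerMnl scaler_eq0 (negPf e0) orbF => /eqP.
- split; first by rewrite /Ga_invariant /h lead_coefE -coefE; exact: Ei.
  apply: (etrans Dg); rewrite Dch; congr (_ + _ * _); apply: eq_map_poly => x.
  by rewrite -alg_mpolyC.
Qed.

Lemma proportional_form_pair (a : 'I_n -> {poly k}) s (z : 'I_n -> k) :
  translate (coaction M) (linear_form a) -> a s != 0 ->
  (forall j, a j = z j *: a s) ->
  exists h : R, large_pedestal_gen (coaction M) h /\ h != 0.
Proof.
move=> ta as0 Da.
have Dla : linear_form a = (a s)^M * (lform (\row_j z j))%:P.
  rewrite /lform rmorph_sum /= mulr_sumr; apply: eq_bigr => j _.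
  rewrite mxE {1}Da -mul_polyC rmorphM /= map_polyC -mul_mpolyC polyCM.
  by rewrite mulrA [_%:P * _]mulrC.
apply: (is_pairI as0 _ (_ : translate _ ((a s)^M * (lform (\row_j z j))%:P))).
  apply: contra_neq as0 => /lform_eq0/rowP/(_ s); rewrite !mxE => zs.
  by rewrite Da zs scale0r.
by rewrite -Dla.
Qed.

Lemma linear_form_additive (a : 'I_n -> {poly k}) :
  additive_over (linear_form a) -> forall j, additive_over (a j).
Proof.
move=> addla.
have bin N m : (linear_form a)`_N *+ m = 0 -> forall j, (a j)`_N *+ m = 0.
  move=> e j; have : lform (\row_j ((a j)`_N *+ m)) = 0.
    rewrite -e linear_form_coef -sumrMnl; apply: eq_bigr => i _.
    by rewrite mxE scalerMnl.
  by move/lform_eq0/rowP/(_ j); rewrite !mxE.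
move=> j; apply: additive_overI => [|i l i0 l0].
  by apply: (bin _ 1%N); apply: additive_over_coef0.
by apply: bin; apply: additive_over_bin.
Qed.

Lemma two_forms_pair (a b : 'I_n -> {poly k}) :
  translate (coaction M) (linear_form a) ->
  translate (coaction M) (linear_form b) ->
  (forall x y : k, (forall j, x *: a j + y *: b j = 0) -> x = 0 /\ y = 0) ->
  exists h : R, large_pedestal_gen (coaction M) h /\ h != 0.
Proof.
move=> ta tb free_ab; have [q kq] := exp_char_exists k.
have adda j : additive_over (a j) by apply: linear_form_additive; case: ta.
have addb j : additive_over (b j) by apply: linear_form_additive; case: tb.
have [s as0] : exists s, a s != 0.
  apply: NNPP => a0; have [j|] := free_ab 1 0; last first.
    by move/eqP; rewrite oner_eq0.
  rewrite scale0r addr0 scale1r; apply/eqP; apply: contraT => aj0.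
  by case: a0; exists j.
case: (classic (exists i j, a i * b j != a j * b i)) => [[i [j det]]|rank1].
  have la0 : linear_form a != 0.
    by apply: contra_neq as0 => /linear_form_eq0.
  have [E [[tE E0] Emin]] : exists E,
      (translate (coaction M) E /\ E != 0) /\
      forall F, translate (coaction M) F -> F != 0 -> (size E <= size F)%N.
    elim: {la0}(size _) {-2}(linear_form a) (leqnn (size (linear_form a))) ta
      la0 => [|m IH] E sE tE E0.
      by move: sE; rewrite leqn0 size_poly_eq0 (negPf E0).
    case: (classic (exists F, [/\ translate (coaction M) F, F != 0
                              & (size F < size E)%N])) => [[F [tF F0 sF]]|noF].
      by apply: (IH F) => //; rewrite -ltnS (leq_trans sF).
    exists E; split=> // F tF F0; rewrite leqNgt; apply/negP => sF.
    by apply: noF; exists F.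
  have dvd := translate_min_dvd (@mpolyC n k) kq tE E0 Emin.
  have [ha [Qa [ha0 ea]]] := dvd _ ta.
  have [hb [Qb [hb0 eb]]] := dvd _ tb.
  (* After multiplication by [E], both sides equal [ha * hb] times the product of the two forms. *)
  have /(linear_form_prime det)[d [H [d0 dH]]] :
      (hb%:P * Qa) * linear_form b = (ha%:P * Qb) * linear_form a.
    apply: (mulIf E0).
    transitivity (hb%:P * (Qa * E) * linear_form b); first by ring.
    transitivity (ha%:P * (Qb * E) * linear_form a); last by ring.
    by rewrite -ea -eb; ring.
  have e : d^M * (hb * ha)%:P = H * E.
    apply: (mulIf la0); rewrite polyCM.
    transitivity (d^M * hb%:P * (ha%:P * linear_form a)); first by ring.
    rewrite ea; transitivity (d^M * (hb%:P * Qa) * E); first by ring.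
    by rewrite dH; ring.
  have [c [x DE]] := dvd_poly_const_split d0 (mulf_neq0 hb0 ha0) e.
  apply: (@is_pairI c x); last by rewrite -DE.
    by apply: contra_neq E0 => c0; rewrite DE c0 rmorph0 mul0r.
  by apply: contra_neq E0 => x0; rewrite DE x0 mulr0.
have rk1 i j : a i * b j = a j * b i.
  by apply/eqP; apply: contraT => det; case: rank1; exists i, j.
(* All minors vanish from here on. If two entries of [a] are independent over [k], the ratio of [b]
   to [a] is a constant [x], against [free_ab]; otherwise every entry of [a] is a scalar multiple of
   [a s]. *)
case: (classic (exists j, free_pair (a s) (a j))) => [[j free_j]|nofree].
  have e : a s * b j = b s * a j by rewrite rk1 mulrC.
  have [x [bs _]] := additive_ratio_const kq (adda s) (adda j) free_j
    (addb s) (addb j) e.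
  have [l|_ /eqP] := free_ab x (-1); last by rewrite oppr_eq0 oner_eq0.
  apply/eqP; rewrite scaleN1r subr_eq0; apply/eqP; apply: (mulfI as0).
  by rewrite rk1 bs -!scalerAr mulrC.
have /fin_all_exists[z Dz] j : exists z : k, a j = z *: a s.
  apply: NNPP => noz; apply: nofree; exists j => x y e.
  have y0 : y = 0.
    apply/eqP; apply: contraT => y0; case: noz; exists (- (y^-1 * x)).
    move/eqP: e; rewrite addrC addr_eq0 => /eqP/(congr1 (GRing.scale y^-1)).
    by rewrite scalerN !scalerA mulVf // scale1r scaleNr.
  split=> //; move/eqP: e; rewrite y0 scale0r addr0 scaler_eq0 (negPf as0) orbF.
  by move/eqP.
exact: proportional_form_pair ta as0 Dz.
Qed.

End Pairs.

(** * Codimension of the fixed forms and the ring of invariants *)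

Section Structure.
Variables (k : closedFieldType) (n : nat) (M : Ga_rep k n).
Hypothesis no_pair : forall h, large_pedestal_gen (coaction M) h -> h = 0.

Lemma no_pair_contra :
  ~ exists h, large_pedestal_gen (coaction M) h /\ h != 0.
Proof. by case=> h [/no_pair-> /eqP]. Qed.

(** A vector [v] outside [B + l] is first replaced by some [v'] fixed modulo [B + l]. A non-zero
    pair then arises from [l] and [v'] together, or from [l] alone, according to whether [v'] is
    fixed modulo [B]. *)
Lemma corank_le1 (B : 'M[k]_n) (l v : 'rV[k]_n) :
  (forall u : 'rV[k]_n, (u <= B)%MS <-> fixed M u) ->
  ~~ (l <= B)%MS ->
  (forall a, (0 < a)%N -> (l *m coef_mx M a <= B)%MS) ->
  (v <= B + l)%MS.
Proof.
move=> fixB lB l2; apply: contraT => /(exists_last_outside M)[i [v'S v'2]].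
set v' := v *m _ in v'S v'2; case: no_pair_contra.
have tr u : (forall a, (0 < a)%N -> (u *m coef_mx M a <= B)%MS) ->
    translate (coaction M) (linear_form (moving_part M u)).
  by move=> u2; apply: moving_part_translate => a a0; apply/fixB; apply: u2.
case: (classic (forall a, (0 < a)%N -> (v' *m coef_mx M a <= B)%MS))
  => [v'B|nv'B].
  (* A vanishing combination of the moving parts says that [x *: l + y *: v'] is fixed, hence in
     [B]; the positions of [v'] and [l] then force [y = 0] and [x = 0]. *)
  apply: (two_forms_pair (tr _ l2) (tr _ v'B)) => x y e.
  have xyB : ((x *: l + y *: v')%R <= B)%MS.
    by apply/fixB; apply: moving_part_eq0 => j; rewrite moving_partD.
  have y0 : y = 0.
    apply/eqP; apply: contraNT v'S => y0.
    have -> : v' = y^-1 *: ((x *: l + y *: v') - x *: l).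
      by rewrite [x *: l + _]addrC addrK scalerA mulVf // scale1r.
    rewrite scalemx_sub // addmx_sub //; last first.
      by rewrite eqmx_opp scalemx_sub // addsmxSr.
    by apply: submx_trans xyB _; apply: addsmxSl.
  split=> //; apply/eqP; apply: contraNT lB => x0.
  have -> : l = x^-1 *: (x *: l + y *: v').
    by rewrite y0 scale0r addr0 scalerA mulVf // scale1r.
  exact: scalemx_sub.
(* Now [v'] moves modulo [B], but only along [l], and [a] is an index where the coefficient of [l]
   is non-zero. *)
have [a [a0 v'aB]] : exists a, (0 < a)%N /\ ~~ (v' *m coef_mx M a <= B)%MS.
  apply: NNPP => H; apply: nv'B => a a0; apply: contraT => v'aB.
  by case: H; exists a.
have dec c : (0 < c)%N -> exists (w : 'rV[k]_n) (x : k),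
    fixed M w /\ v' *m coef_mx M c = w + x *: l.
  move=> /v'2/sub_addsmxP[[u1 u2] /= ->].
  exists (u1 *m B), (u2 0 0); split; first by apply/fixB; apply: submxMl.
  by rewrite {1}[u2]mx11_scalar mul_scalar_mx.
have [w [x [fw ew]]] := dec a a0.
have x0 : x != 0.
  by apply: contraNneq v'aB => x0; rewrite ew x0 scale0r addr0; apply/fixB.
(* The [coef_mx M c] commute, so every [l *m coef_mx M c] lies on one line. *)
have prop c : (0 < c)%N ->
    exists z, l *m coef_mx M c = z *: (l *m coef_mx M a).
  move=> c0; have [w' [x' [fw' ew']]] := dec c c0; exists (x^-1 * x').
  have : v' *m coef_mx M a *m coef_mx M c = v' *m coef_mx M c *m coef_mx M a.
    by rewrite -!mulmxA coef_mx_comm.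
  rewrite ew ew' !mulmxDl fw // fw' // !add0r -!scalemxAl.
  by move/(congr1 (fun y => x^-1 *: y)); rewrite !scalerA mulVf // scale1r.
have [s ls0] : exists s, (l *m coef_mx M a) 0 s != 0.
  apply: NNPP => H; move/negP: lB; apply; apply/fixB => c c0.
  have [z ->] := prop c c0; have -> : l *m coef_mx M a = 0; last exact: scaler0.
  apply/rowP=> j; rewrite [RHS]mxE; apply/eqP; apply: contraT => lj.
  by case: H; exists j.
(* All coefficients of the moving part of [l] are multiples of [l M_a], so its entries are
   proportional to the entry at [s], with the ratios read off [l M_a]. *)
apply: (proportional_form_pair (s := s)
  (z := fun j => (l *m coef_mx M a) 0 j / (l *m coef_mx M a) 0 s) (tr _ l2)).
  apply: contra_neq ls0 => ms0.
  by have := coef_moving_part M l s a; rewrite gtn_eqF // ms0 coef0.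
move=> j; apply/polyP=> c; rewrite coefZ !coef_moving_part.
case: posnP => [_|c0]; first by rewrite mulr0.
have [z ->] := prop c c0; move: (l *m coef_mx M a) ls0 => r rs0.
by rewrite [in LHS]mxE [in RHS]mxE mulrCA divfK.
Qed.

(** The value [l = 0] covers the trivial representation, where every form is fixed. *)
Lemma fixed_corank_le1 (B : 'M[k]_n) :
  (forall u : 'rV[k]_n, (u <= B)%MS <-> fixed M u) ->
  exists l : 'rV[k]_n, (l = 0 \/ ~~ (l <= B)%MS) /\
    forall v : 'rV[k]_n, (v <= B + l)%MS.
Proof.
move=> fixB; case: (classic (forall v : 'rV[k]_n, (v <= B)%MS)) => [Bfull|].
  exists 0; split; first by left.
  by move=> v; apply: submx_trans (Bfull v) (addsmxSl _ _).
move=> nBfull; have [u uB] : exists u : 'rV[k]_n, ~~ (u <= B)%MS.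
  apply: NNPP => H; apply: nBfull => v; apply: contraT => vB.
  by case: H; exists v.
have [i [lB l2]] := exists_last_outside M uB.
exists (u *m coef_mx M i); split; first by right.
by move=> v; apply: corank_le1.
Qed.

Lemma Ga_invariantP (f : {mpoly k[n]}) :
  Ga_invariant (coaction M) f -> sym_sub (dual_invariant M) f.
Proof.
have [B fixB] := fixed_mx M; have [l [lB lfull]] := fixed_corank_le1 fixB.
pose w := [tuple lform (row i B) | i < n].
have fixed_w i : fixed M (row i B) by apply/fixB; apply: row_sub.
(* [S] is the subring generated by the fixed forms: the rows of [B] span them. *)
pose S (p : {mpoly k[n]}) := exists q : {mpoly k[n]}, p = q \mPo w.
have SD p q : S p -> S q -> S (p + q).
  by case=> p' -> [q' ->]; exists (p' + q'); rewrite rmorphD.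
have SM p q : S p -> S q -> S (p * q).
  by case=> p' -> [q' ->]; exists (p' * q'); rewrite rmorphM.
have SC (c : k) : S c%:MP by exists c%:MP; rewrite comp_mpolyC.
have S0 : S 0 by have := SC 0; rewrite mpolyC0.
have S1 : S 1 by have := SC 1; rewrite mpolyC1.
have SB (u : 'rV[k]_n) : S (lform (u *m B)).
  exists (lform u); rewrite mulmx_sum_row {2}/lform rmorph_sum /=.
  rewrite (big_morph _ (@lformD k n) (@lform0 k n)); apply: eq_bigr => i _.
  by rewrite lformZ comp_mpolyZ comp_mpolyXU -tnth_nth tnth_mktuple.
have S_inv p : S p -> coaction M p = p%:P.
  case=> q ->; elim/mpoly_subring_ind: q => [p1 p2 e1 e2|p1 p2 e1 e2|c|j].
  - by rewrite rmorphD /= coactionD e1 e2 polyCD.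
  - by rewrite rmorphM /= coactionM e1 e2 polyCM.
  - by rewrite comp_mpolyC coactionC.
  - rewrite comp_mpolyXU -tnth_nth tnth_mktuple.
    exact: coaction_lform_fixed.
(* Every variable is a fixed form plus a multiple of [lform l], so the whole ring is generated over
   [S] by [lform l]. *)
have Sql g :
    exists q : {poly {mpoly k[n]}}, (forall i, S q`_i) /\ g = q.[lform l].
  elim/mpoly_subring_ind: g => [_ _ [p [Sp ->]] [q [Sq ->]]|
      _ _ [p [Sp ->]] [q [Sq ->]]|c|j].
  - by exists (p + q); split=> [i|]; rewrite ?hornerD // coefD; apply: SD.
  - exists (p * q); split=> [i|]; rewrite ?hornerM // coefM.
    by apply: (big_ind S) => // r _; apply: SM.
  - exists (c%:MP)%:P; split=> [i|]; rewrite ?hornerC // coefC.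
    by case: eqP.
  - have /sub_addsmxP[[u1 u2] /= e] := lfull (delta_mx 0 j).
    exists ((u2 0 0)%:MP%:P * 'X + (lform (u1 *m B))%:P); split=> [i|].
      rewrite coefD coefCM coefX coefC.
      by apply: SD; [apply: SM => //; case: (_ == _) | case: (_ == _)].
    rewrite -lform_delta e lformD {1}[u2]mx11_scalar mul_scalar_mx lformZ.
    by rewrite !hornerE mul_mpolyC addrC.
have [q [Sq Df]] := Sql f; move=> fi.
have fS : S f.
  case: lB => [l0|lB].
    by rewrite Df l0 lform0 horner_coef0.
  (* The co-action fixes the coefficients of [q], so it only substitutes the image of [lform l]. *)
  have Dbf : coaction M f = q \Po coaction M (lform l).
    rewrite Df horner_coef coaction_sum comp_polyE; apply: eq_bigr => i _.
    rewrite coactionM S_inv // mul_polyC; congr (_ *: _).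
    exact: (rmorphXn (coaction M)).
  have szl : (1 < size (coaction M (lform l)))%N.
    rewrite ltnNge; apply: contra lB => /leq_sizeP sl; apply/fixB => N N0.
    by apply: lform_eq0; rewrite -coaction_lform_coef sl.
  (* Degrees in [t] multiply under composition over a domain; the composite is constant and the
     inner polynomial is not, so [q] is constant. *)
  have sq : (size q <= 1)%N.
    have := size_comp_poly q (coaction M (lform l)).
    rewrite -Dbf fi; have := size_polyC_leq1 f.
    move: (size _) szl (size _) (size q) => x.
    by case: x => [|[|x]] // _ y z; nia.
  by rewrite Df (size1_polyC sq) hornerC.
have [p Dp] := fS; exists n, w, p; split=> // i; rewrite tnth_mktuple.
split; [exact: lform_homog | exact: coaction_lform_fixed].
Qed.

End Structure.

Theorem theorem4p6 (k : closedFieldType) (n : nat) (beta : Ga_rep k n)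
  (hP : forall f : {mpoly k[n]},
      large_pedestal_ideal (coaction beta) f <-> f = 0) :
  forall f : {mpoly k[n]},
    Ga_invariant (coaction beta) f <-> sym_sub (dual_invariant beta) f.
Proof.
move=> f; split.
  apply: Ga_invariantP => h hgen; apply/hP.
  by exists 1%N, (fun=> 1), (fun=> h); rewrite big_ord1 mul1r.
case=> m [w [p [winv ->]]]; rewrite /Ga_invariant.
elim/mpoly_subring_ind: p => [p1 p2 e1 e2|p1 p2 e1 e2|c|j].
- by rewrite rmorphD /= coactionD e1 e2 polyCD.
- by rewrite rmorphM /= coactionM e1 e2 polyCM.
- by rewrite comp_mpolyC coactionC.
- by rewrite comp_mpolyXU -tnth_nth; case: (winv j).
Qed.
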